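(* Let $n$ be a one-dimensional real-valued, zero-mean, wide-sense stationary process with covariance function $\Gamma_n\in \mathrm L^1(\mathbb{R})\cap \mathrm L^2(\mathbb{R})$. Then, for all $(m,m')\in\{0,\ldots,M-1\}^2$ and all $\ell\in\mathbb{Z}$, we have $$\lim_{j\to\infty}\Gamma_{n_{j,m},n_{j,m'}}[\ell]=\widehat\Gamma_n(0)\,\delta_{m-m'}\,\delta_\ell,$$ $$\lim_{j\to\infty}\Gamma_{n_{j,m},n^{\mathrm H}_{j,m'}}[\ell]=\widehat\Gamma_n(0)\,\gamma_{\psi_m,\psi^{\mathrm H}_{m'}}(-\ell).$$
   Context: Fourier transform: $\widehat a(\omega)=\int a(t)e^{-\imath\omega t}dt$. $\delta_k=1$ if $k=0$ and $0$ otherwise. $M\ge 2$ is an integer. $M$-band dual-tree wavelets: $\psi_0\in \mathrm L^2(\mathbb{R})$ is the (real-valued) scaling function and $\psi_1,\ldots,\psi_{M-1}\in \mathrm L^2(\mathbb{R})$ are the (real-valued) mother wavelets of an orthonormal $M$-band multiresolution analysis. They satisfy $\sqrt M\,\widehat\psi_m(M\omega)=H_m(\omega)\widehat\psi_0(\omega)$ for $m\in\{0,\ldots,M-1\}$, where the $H_m$ are $2\pi$-periodic frequency responses with $\sum_{p=0}^{M-1}H_m(\omega+\frac{2\pi p}{M})H_{m'}^*(\omega+\frac{2\pi p}{M})=M\delta_{m-m'}$; the functions $M^{-j/2}\psi_m(M^{-j}t-k)$, $1\le m\le M-1$, $j,k\in\mathbb{Z}$, form an orthonormal basis of $\mathrm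 L^2(\mathbb{R})$, and $\{\psi_m(\cdot-k): 0\le m\le M-1,\ k\in\mathbb{Z}\}$ is an orthonormal family. The dual functions $\psi_m^{\mathrm H}$ (real-valued, in $\mathrm L^2(\mathbb{R})$) are given by $\widehat\psi{}_m^{\mathrm H}(\omega)=-\imath\,\mathrm{sign}(\omega)\widehat\psi_m(\omega)$ for $m\ge1$ and, with $d$ a fixed integer, by $\widehat\psi{}_0^{\mathrm H}(\omega)=(-1)^k e^{-\imath(d+\frac12)\omega}\widehat\psi_0(\omega)$ if $\omega\in[2k\pi,2(k+1)\pi)$ with $k\ge0$, and $\widehat\psi{}_0^{\mathrm H}(\omega)=(-1)^{k+1} e^{-\imath(d+\frac12)\omega}\widehat\psi_0(\omega)$ if $\omega\in[2k\pi,2(k+1)\pi)$ with $k<0$. Autocovariance: $\Gamma_n(\tau)=\mathsf{E}\{n(x+\tau)n(x)\}$ for all $\tau,x\in\mathbb{R}$. Cross-correlation of real-valued $f,g\in \mathrm L^2(\mathbb{R})$: $\gamma_{f,g}(\tau)=\int_{-\infty}^\infty f(x)g(x-\tau)\,dx$. Coefficients at resolution level $j\in\mathbb{Z}$: $n_{j,m}[k]=\int n(x)M^{-j/2}\psi_m(M^{-j}x-k)\,dx$ and $n^{\mathrm H}_{j,m}[k]=\int n(x)M^{-j/2}\psi^{\mathrm H}_m(M^{-j}x-k)\,dx$. The symbol $\Gamma_{u,v}[\ell]$ denotes $\mathsf{E}\{u[k+\ell]v[k]\}$ (independent of $k$). It is assumed throughout that the exchange of expectation and integrals in computing these covariances is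 legitimate, so that $\Gamma_{n_{j,m},n_{j,m'}}[\ell]=\int\Gamma_n(x)\gamma_{\psi_m,\psi_{m'}}(M^{-j}x-\ell)dx$ and $\Gamma_{n_{j,m},n^{\mathrm H}_{j,m'}}[\ell]=\int\Gamma_n(x)\gamma_{\psi_m,\psi^{\mathrm H}_{m'}}(M^{-j}x-\ell)dx$. *)

(* Defs.v *)
From HB Require Import structures.
From mathcomp Require Import all_boot all_order all_algebra.
From mathcomp Require Import complex.
From mathcomp Require Import all_classical all_reals all_analysis.

Set Implicit Arguments.
Unset Strict Implicit.
Unset Printing Implicit Defensive.

Import Order.TTheory GRing.Theory Num.Theory.
Import numFieldNormedType.Exports.

Local Open Scope classical_set_scope.
Local Open Scope complex_scope.
Local Open Scope ring_scope.

(* R[i] seen as a numFieldType, which is where limits in R[i] get their topology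
   (the one of the modulus). *)
Definition complex_numField (R : realType) : numFieldType := R[i].

Section Fourier.
Context {R : realType}.
Local Notation mu := (@lebesgue_measure R).

Definition expi (t : R) : R[i] := cos t +i* sin t.

Definition cmeasurable (F : R -> R[i]) : Prop :=
  measurable_fun setT (@complex.Re R \o F) /\
  measurable_fun setT (@complex.Im R \o F).

Definition cintegral (D : set R) (F : R -> R[i]) : R[i] :=
  (\int[mu]_(t in D) complex.Re (F t)) +i* (\int[mu]_(t in D) complex.Im (F t)).

Definition fourier_on (D : set R) (f : R -> R) (w : R) : R[i] :=
  cintegral D (fun t => (f t)%:C * expi (- (w * t))).

(* The transform of an integrable function, defined at every frequency. *)
Definition fourier (f : R -> R) : R -> R[i] := fourier_on setT f.

(* F represents the (Plancherel) transform of the square-integrable f: it is the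
   L^2 limit of the transforms of the truncations of f.  F is only determined up
   to equality almost everywhere. *)
Definition is_fourier2 (f : R -> R) (F : R -> R[i]) : Prop :=
  [/\ f \in Lfun mu 2%:E, cmeasurable F &
    (\int[mu]_w
       ((ComplexField.Normc.normc (F w - fourier_on `[- N%:R, N%:R] f w)) ^+ 2)%:E)%E
      @[N --> \oo] --> 0%E].

End Fourier.

Section Wavelets.
Context {R : realType}.
Local Notation mu := (@lebesgue_measure R).

Definition xcorr (f g : R -> R) (tau : R) : R :=
  \int[mu]_x (f x * g (x - tau)).

Definition L2dist (f g : R -> R) : \bar R :=
  'N[mu]_2%:E[EFin \o (f \- g)%R]%E.

Definition orthonormal (I : eqType) (e : I -> R -> R) : Prop :=
  (forall i, e i \in Lfun mu 2%:E) /\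
  (forall i i', \int[mu]_x (e i x * e i' x) = (i == i')%:R).

Definition closed_span (I : Type) (e : I -> R -> R) : set (R -> R) :=
  [set f | f \in Lfun mu 2%:E /\
    forall eps : R, 0 < eps -> exists (s : seq I) (c : I -> R),
      (L2dist f (fun x => \sum_(i <- s) c i * e i x)%R < eps%:E)%E].

Definition orthonormal_basis (I : eqType) (e : I -> R -> R) (V : set (R -> R)) :
  Prop := orthonormal e /\ closed_span e = V.

(* M^(-j/2) f(M^(-j) x - k): larger j means coarser resolution. *)
Definition atom (M : nat) (f : R -> R) (j k : int) (x : R) : R :=
  M%:R `^ (- (j%:~R / 2)) * f (M%:R ^ (- j) * x - k%:~R).

Definition mra_space (M : nat) (phi : R -> R) (j : int) : set (R -> R) :=
  closed_span (atom M phi j).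

Record multiresolution (M : nat) (phi : R -> R) : Prop := {
  mra_orthonormal : orthonormal (atom M phi 0) ;
  mra_nested : forall j : int, mra_space M phi (j + 1) `<=` mra_space M phi j ;
  mra_separated : forall f : R -> R, (forall j, mra_space M phi j f) ->
    {ae mu, forall x, f x = 0} ;
  mra_dense : forall f : R -> R, f \in Lfun mu 2%:E ->
    forall eps : R, 0 < eps -> exists (j : int) (g : R -> R),
      mra_space M phi j g /\ (L2dist f g < eps%:E)%E }.

(* psi 0 is the scaling function and psi 1, ..., psi M.-1 are the wavelets; the
   values of psi, hpsi and H at indices >= M play no role.  hpsi m represents
   the transform of psi m, whence the relations almost everywhere. *)
Record mband_wavelets (M : nat) (psi : nat -> R -> R) (hpsi : nat -> R -> R[i])
    (H : nat -> R -> R[i]) : Prop := {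
  mbw_mra : multiresolution M (psi 0%N) ;
  mbw_step : orthonormal_basis
    (fun mk : 'I_M * int => atom M (psi mk.1) 0 mk.2)
    (mra_space M (psi 0%N) (- 1)) ;
  mbw_basis : orthonormal_basis
    (fun mjk : 'I_M.-1 * int * int => atom M (psi mjk.1.1.+1) mjk.1.2 mjk.2)
    [set f | f \in Lfun mu 2%:E] ;
  mbw_fourier : forall m, (m < M)%N -> is_fourier2 (psi m) (hpsi m) ;
  mbw_filter_measurable : forall m, (m < M)%N -> cmeasurable (H m) ;
  mbw_filter_periodic : forall m, (m < M)%N ->
    forall w, H m (w + 2 * pi) = H m w ;
  mbw_two_scale : forall m, (m < M)%N -> {ae mu, forall w,
    (Num.sqrt M%:R)%:C * hpsi m (M%:R * w) = H m w * hpsi 0%N w} ;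
  mbw_paraunitary : forall m m', (m < M)%N -> (m' < M)%N -> {ae mu, forall w,
    \sum_(p < M) H m (w + 2 * pi * p%:R / M%:R)
                 * (H m' (w + 2 * pi * p%:R / M%:R))^*%C =
    (M%:R * (m == m')%:R : R)%:C} }.

Record dual_wavelets (M : nat) (d : int) (hpsi : nat -> R -> R[i])
    (psiH : nat -> R -> R) (hpsiH : nat -> R -> R[i]) : Prop := {
  dual_fourier : forall m, (m < M)%N -> is_fourier2 (psiH m) (hpsiH m) ;
  dual_wavelet : forall m, (0 < m < M)%N -> {ae mu, forall w,
    hpsiH m w = - 'i%C * (Num.sg w)%:C * hpsi m w} ;
  dual_scaling_ge0 : {ae mu, forall w, forall k : int, 0 <= k ->
    2 * k%:~R * pi <= w < 2 * (k + 1)%:~R * pi ->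
    hpsiH 0%N w = (- 1) ^ k * expi (- ((d%:~R + 2^-1) * w)) * hpsi 0%N w} ;
  dual_scaling_lt0 : {ae mu, forall w, forall k : int, k < 0 ->
    2 * k%:~R * pi <= w < 2 * (k + 1)%:~R * pi ->
    hpsiH 0%N w =
      (- 1) ^ (k + 1) * expi (- ((d%:~R + 2^-1) * w)) * hpsi 0%N w} }.

End Wavelets.

Section Noise.
Context {d : measure_display} {T : measurableType d} {R : realType}.
Context (P : probability T R) (n : R -> {RV P >-> R}).
Local Notation mu := (@lebesgue_measure R).

Record wide_sense_stationary (Gamma : R -> R) : Prop := {
  wss_square : forall x, (n x : T -> R) \in Lfun P 2%:E ;
  wss_zero_mean : forall x, 'E_P[n x]%E = 0%E ;
  wss_autocovariance : forall tau x,
    'E_P[fun t => (n (x + tau) t * n x t)%R]%E = (Gamma tau)%:E }.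

Definition path_integral (a : R -> R) (t : T) : R :=
  \int[mu]_x (n x t * a x).

Definition coef (M : nat) (f : R -> R) (j k : int) : T -> R :=
  path_integral (atom M f j k).

Definition crosscov (u v : int -> T -> R) (k l : int) : R :=
  fine 'E_P[fun t => (u (k + l) t * v k t)%R]%E.

(* Expectation and integrals may be exchanged in the covariance of the two path
   integrals; the left-hand side is extended-real valued, so that the equation
   also asserts that this covariance is finite. *)
Definition exchangeable_with (a b : R -> R) : Prop :=
  'E_P[fun t => (path_integral a t * path_integral b t)%R]%E =
  (\int[mu]_x \int[mu]_y
     (fine 'E_P[fun t => (n x t * n y t)%R]%E * a x * b y))%:E.

Definition legitimate_exchange (M : nat) (psi psiH : nat -> R -> R) : Prop :=
  forall m m', (m < M)%N -> (m' < M)%N -> forall j k k' : int,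
    exchangeable_with (atom M (psi m) j k) (atom M (psi m') j k') /\
    exchangeable_with (atom M (psi m) j k) (atom M (psiH m') j k').

End Noise.

(* Main.v *)
Require Import Defs.
From HB Require Import structures.
From mathcomp Require Import all_boot all_order all_algebra.
From mathcomp Require Import complex.
From mathcomp Require Import all_classical all_reals all_analysis.
From mathcomp Require Import measurable_realfun ring lra.

Set Implicit Arguments.
Unset Strict Implicit.
Unset Printing Implicit Defensive.

Import Order.TTheory GRing.Theory Num.Theory.
Import numFieldNormedType.Exports.

Local Open Scope classical_set_scope.
Local Open Scope complex_scope.
Local Open Scope ring_scope.

(** The limit is a dominated convergence argument applied to one formula for the
    covariance.  Write f and g for the two generating functions and a and b for
    their atoms at resolution j.  Exchanging expectation and integrals turns the
    covariance of the coefficients into the double integral of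
    Gamma(x - y) a(x) b(y); the substitution y = x - u and Fubini's theorem turn
    that into the integral of Gamma(u) times the cross-correlation of a and b at u
    ([covariance_xcorr]).  An affine change of variable, in which the two factors
    M^(-j/2) cancel the Jacobian M^j, gives
    xcorr a b u = xcorr f g (M^(-j) u - l) ([xcorr_atom]).  Hence
      covariance at lag l = integral of Gamma(u) xcorr f g (M^(-j) u - l) du.
    As j grows, M^(-j) u tends to 0 for every u.  The cross-correlation of two
    square-integrable functions is bounded ([abs_xcorr_le]) and continuous
    ([xcorr_continuous]), and Gamma is integrable, so the integral tends to
    (integral of Gamma) * xcorr f g (- l), where the first factor is the Fourier
    transform of Gamma at 0.

    The analytic core is the continuity of the cross-correlation.  Truncating f
    to a bounded function with bounded support changes xcorr f g by a uniformly
    small amount, by Young's inequality |ab| <= (c a^2 + b^2 / c) / 2 with a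
    large weight c on the truncation error.  For the truncated f only the values
    of g on a segment matter, so g can be replaced by a continuous function that
    is L1-close to it there; and the cross-correlation with a continuous
    function is continuous by dominated convergence.

    Both limits are instances of this one, with g = psi m' and g = psiH m'.  In the
    first, xcorr (psi m) (psi m') (- l) is an inner product of integer translates,
    and orthonormality evaluates it to two Kronecker symbols ([xcorr_mband]). *)

(** * Affine change of variable and Fubini's theorem for real integrals *)

Section AffineSubstitution.
Context {R : realType}.
Local Notation mu := (@lebesgue_measure R).

Lemma measurable_affine (c b : R) :
  measurable_fun setT (fun x : R => c * x + b).
Proof. by apply: measurable_funD => //; exact: measurable_funM. Qed.

(** The candidate for Lebesgue measure: a unit length is read through x |->
    c x + b as a length 1 / |c|, which the factor |c| compensates. *)
Local Definition affine_image (c b : R) :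
    {measure set (measurableTypeR R) -> \bar R} :=
  mscale (NngNum (normr_ge0 c))
    (measure_function_pushforward__canonical__measure_function_Measure mu
      (measurable_affine c b : measurable_fun [set: measurableTypeR R]
        (fun x : R => c * x + b : measurableTypeR R))).

(** Lebesgue measure is determined by its values on half-open intervals, and the
    preimage of an interval is an interval whose length is divided by |c|. *)
Lemma lebesgue_measure_affine (c b : R) (A : set R) : c != 0 -> measurable A ->
  mu A = affine_image c b A.
Proof.
move=> c0 mA; apply: lebesgue_measure_unique => // X [[p q] _ <-] /=.
rewrite /affine_image /mscale /= /pushforward /=.
have [c_gt0|c_lt0|/eqP] := ltrgtP 0 c; last by rewrite eq_sym (negbTE c0).
- have -> : (fun x => c * x + b) @^-1` `]p, q]%classic =
      `](p - b) / c, (q - b) / c]%classic.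
    apply/seteqP; split => x /=; rewrite !in_itv/= ltr_pdivrMr// ler_pdivlMr//.
      by rewrite ltrBlDr lerBrDr mulrC.
    by rewrite ltrBlDr lerBrDr mulrC.
  rewrite !lebesgue_measure_itv/= !lte_fin ltr_pM2r ?invr_gt0// ltrD2r.
  case: ifPn => // _; last by rewrite mule0.
  rewrite -!EFinB -EFinM gtr0_norm//; congr (_%:E); field.
  by [].
- have -> : (fun x => c * x + b) @^-1` `]p, q]%classic =
      `[(q - b) / c, (p - b) / c[%classic.
    apply/seteqP; split => x /=; rewrite !in_itv/= ler_ndivrMr// ltr_ndivlMr//.
      by rewrite ltrBlDr lerBrDr mulrC andbC.
    by rewrite ltrBlDr lerBrDr mulrC andbC.
  rewrite !lebesgue_measure_itv/= !lte_fin ltr_nM2r ?invr_lt0// ltrD2r.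
  case: ifPn => // _; last by rewrite mule0.
  rewrite -!EFinB -EFinM ltr0_norm//; congr (_%:E); field.
  by [].
Qed.

Lemma ge0_integral_affine (c b : R) (f : R -> \bar R) : c != 0 ->
  measurable_fun setT f -> (forall x, 0 <= f x)%E ->
  (\int[mu]_x f x = `|c|%:E * \int[mu]_x f (c * x + b)%R)%E.
Proof.
move=> c0 mf f0.
transitivity (\int[affine_image c b]_x f x)%E.
  by apply: eq_measure_integral => A mA _; exact: lebesgue_measure_affine.
rewrite /affine_image ge0_integral_mscale//= ge0_integral_pushforward//.
exact: measurable_affine.
Qed.

(** The integrals of the positive and negative parts scale by the same factor |c|.
    When one of them is infinite, so is its counterpart on the other side, and both
    real-valued integrals are 0. *)
Lemma Rintegral_affine (c b : R) (f : R -> R) : c != 0 ->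
  measurable_fun setT f ->
  \int[mu]_x f x = `|c| * \int[mu]_x f (c * x + b).
Proof.
move=> c0 mf; rewrite /Rintegral.
have mEf : measurable_fun setT (EFin \o f) by exact/measurable_EFinP.
pose phi (x : R) := c * x + b.
rewrite integralE [in RHS](_ : \int[mu]_x _ = \int[mu]_x ((EFin \o f) \o phi) x)%E//.
rewrite [in RHS]integralE (funepos_comp _ phi) (funeneg_comp _ phi).
rewrite (@ge0_integral_affine c b (EFin \o f)^\+%E)//; last exact: measurable_funepos.
rewrite (@ge0_integral_affine c b (EFin \o f)^\-%E)//; last exact: measurable_funeneg.
have Ip : (0 <= \int[mu]_x ((EFin \o f)^\+ \o phi) x)%E.
  by apply: integral_ge0 => x _ /=; rewrite ?funepos_ge0 ?funeneg_ge0.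
have In : (0 <= \int[mu]_x ((EFin \o f)^\- \o phi) x)%E.
  by apply: integral_ge0 => x _ /=; rewrite ?funepos_ge0 ?funeneg_ge0.
rewrite -/(phi _) /=.
have cp : (0 < `|c|%:E)%E by rewrite lte_fin normr_gt0.
move: Ip In; set A := integral _ _ _; set B := integral _ _ _.
case: A => [A| |] //= _; case: B => [B| |] //= _;
  rewrite ?gt0_muley//= ?mulr0//.
by rewrite mulrBr.
Qed.

End AffineSubstitution.

Section RFubini.
Context d1 d2 (T1 : measurableType d1) (T2 : measurableType d2) (R : realType).
Variable m1 : {sigma_finite_measure set T1 -> \bar R}.
Variable m2 : {sigma_finite_measure set T2 -> \bar R}.
Variable f : T1 * T2 -> R.
Hypothesis imf : (m1 \x m2)%E.-integrable setT (EFin \o f).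

(** The inner real-valued integrals agree with the extended ones where the
    sections of f are integrable, that is, almost everywhere. *)
Lemma Rintegral_fubini :
  \int[m1]_x \int[m2]_y f (x, y) = \int[m2]_y \int[m1]_x f (x, y).
Proof.
rewrite /Rintegral; congr fine.
have mF := measurable_fubini_F imf; have mG := measurable_fubini_G imf.
transitivity (\int[m1]_x \int[m2]_y (EFin \o f) (x, y))%E; last first.
  rewrite Fubini//; apply: ae_eq_integral => //.
  - by apply/measurable_EFinP; exact: measurableT_comp.
  - apply: filterS (ae_integrable2 imf) => y /= iy _.
    by rewrite fineK//; exact: integrable_fin_num.
apply: ae_eq_integral => //.
- by apply/measurable_EFinP; exact: measurableT_comp.
- apply: filterS (ae_integrable1 imf) => x /= ix _.
  by rewrite fineK//; exact: integrable_fin_num.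
Qed.

End RFubini.

(** * Square-integrable functions: cross-correlation bounds and truncation *)

Section SquareIntegrable.
Context {R : realType}.
Local Notation mu := (@lebesgue_measure R).

Lemma Lfun2P (f : R -> R) : f \in Lfun mu 2%:E <->
  measurable_fun setT f /\ mu.-integrable setT (EFin \o (fun x => f x ^+ 2)).
Proof.
split=> [f2|[mf /integrableP[_ fi]]].
  split; last exact: Lfun2_integrable_sqr.
  by move: f2; rewrite inE => /andP[]; rewrite inE.
rewrite inE; apply/andP; split; rewrite inE//= /finite_norm unlock.
apply: poweR_lty; apply: le_lt_trans fi.
rewrite le_eqVlt; apply/orP; left; apply/eqP/eq_integral => x _ /=.
by rewrite normrX powR_mulrn.
Qed.

Lemma integrable_affine (c b : R) (f : R -> R) : c != 0 ->
  mu.-integrable setT (EFin \o f) ->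
  mu.-integrable setT (EFin \o (fun x => f (c * x + b))).
Proof.
move=> c0 /integrableP[mf fi]; apply/integrableP; split.
  apply/measurable_EFinP; apply: measurableT_comp (measurable_affine c b).
  exact/measurable_EFinP.
have ma : measurable_fun setT (fun x => `|(EFin \o f) x|)%E.
  by apply: measurableT_comp.
move: fi; rewrite (ge0_integral_affine b c0 ma)//=.
move=> fi; rewrite ltNge leye_eq; apply/negP => /eqP fy.
by move: fi; rewrite fy gt0_muley ?ltxx// lte_fin normr_gt0.
Qed.

Lemma Lfun2_affine (c b : R) (f : R -> R) : c != 0 ->
  f \in Lfun mu 2%:E -> (fun x => f (c * x + b)) \in Lfun mu 2%:E.
Proof.
move=> c0 /Lfun2P[mf fi]; apply/Lfun2P; split.
  exact: measurableT_comp (measurable_affine c b).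
exact: (integrable_affine b c0 fi).
Qed.

Lemma Lfun2_shift (u : R) (f : R -> R) :
  f \in Lfun mu 2%:E -> (fun x => f (x - u)) \in Lfun mu 2%:E.
Proof.
move=> f2; have := @Lfun2_affine 1 (- u) f (oner_neq0 R) f2.
by under eq_fun do rewrite mul1r.
Qed.

Lemma integrable_scale (c : R) (f : R -> R) :
  mu.-integrable setT (EFin \o f) ->
  mu.-integrable setT (EFin \o (fun x => c * f x)).
Proof. by move=> fi; exact: (integrableZl measurableT c fi). Qed.

Lemma integrable_add (f g : R -> R) :
  mu.-integrable setT (EFin \o f) -> mu.-integrable setT (EFin \o g) ->
  mu.-integrable setT (EFin \o (fun x => f x + g x)).
Proof. by move=> fi gi; exact: (integrableD measurableT fi gi). Qed.

Definition energy (f : R -> R) : R := \int[mu]_x (f x ^+ 2).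

Lemma energy_ge0 (f : R -> R) : 0 <= energy f.
Proof. by apply: Rintegral_ge0 => x _; exact: sqr_ge0. Qed.

Lemma energy_shift (u : R) (f : R -> R) : f \in Lfun mu 2%:E ->
  energy (fun x => f (x - u)) = energy f.
Proof.
move=> /Lfun2P[mf _]; rewrite /energy.
rewrite [RHS](@Rintegral_affine _ 1 (- u)) ?oner_neq0//; last exact: measurable_funX.
by rewrite normr1 mul1r; apply: eq_Rintegral => x _; rewrite mul1r.
Qed.

Lemma xcorr_integrable (f g : R -> R) (u : R) :
  f \in Lfun mu 2%:E -> g \in Lfun mu 2%:E ->
  mu.-integrable setT (EFin \o (fun x => f x * g (x - u))).
Proof.
move=> f2 /(Lfun2_shift u) g2.
exact/Lfun1_integrable/(Lfun2_mul_Lfun1 f2 g2).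
Qed.

(** Young's inequality |ab| <= (c a^2 + b^2 / c) / 2 under the integral.  The free
    weight c lets a function of small energy absorb one of large energy. *)
Lemma xcorr_abs_le (f g : R -> R) (u c : R) : 0 < c ->
  f \in Lfun mu 2%:E -> g \in Lfun mu 2%:E ->
  \int[mu]_x `|f x * g (x - u)| <= (c * energy f + c^-1 * energy g) / 2.
Proof.
move=> c0 f2 g2.
have i1 := xcorr_integrable u f2 g2.
have [mf if2] := (Lfun2P f).1 f2.
have [mgu ig2] := (Lfun2P _).1 (Lfun2_shift u g2).
rewrite -(energy_shift u g2) /energy.
have icf := integrable_scale c if2; have icg := integrable_scale c^-1 ig2.
have isum := integrable_add icf icg.
rewrite -!RintegralZl// -RintegralD// mulrC -RintegralZl//.
apply: le_Rintegral => //.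
- exact: integrable_norm.
- exact: integrable_scale.
move=> x _; rewrite normrM; set a := f x; set b := g _.
rewrite -(real_normK (num_real a)) -(real_normK (num_real b)).
have : 0 <= (c * `|a| - `|b|) ^+ 2 * c^-1.
  by rewrite mulr_ge0 ?sqr_ge0// invr_ge0 ltW.
have -> : (c * `|a| - `|b|) ^+ 2 * c^-1 =
    c * `|a| ^+ 2 + c^-1 * `|b| ^+ 2 - 2 * (`|a| * `|b|).
  by field; rewrite gt_eqF.
lra.
Qed.

Lemma abs_xcorr_le (f g : R -> R) (u c : R) : 0 < c ->
  f \in Lfun mu 2%:E -> g \in Lfun mu 2%:E ->
  `|xcorr f g u| <= (c * energy f + c^-1 * energy g) / 2.
Proof.
move=> c0 f2 g2; apply: le_trans (xcorr_abs_le u c0 f2 g2).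
by apply: le_normr_Rintegral => //; exact: xcorr_integrable.
Qed.

Definition truncate (N : R) (f : R -> R) (x : R) : R :=
  if (`|x| <= N) && (`|f x| <= N) then f x else 0.

Lemma measurable_truncate N f :
  measurable_fun setT f -> measurable_fun setT (truncate N f).
Proof.
move=> mf; apply: measurable_fun_ifT => //.
apply: measurable_and; apply: measurable_fun_ler => //; exact: measurableT_comp.
Qed.

Lemma truncate_sqr_le N f x : truncate N f x ^+ 2 <= f x ^+ 2.
Proof. by rewrite /truncate; case: ifP => // _; rewrite expr0n sqr_ge0. Qed.

Lemma truncate_sub_sqr_le N f x : (f x - truncate N f x) ^+ 2 <= f x ^+ 2.
Proof.
by rewrite /truncate; case: ifP => _; rewrite ?subr0// subrr expr0n sqr_ge0.
Qed.

Lemma Lfun2_truncate N f : f \in Lfun mu 2%:E -> truncate N f \in Lfun mu 2%:E.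
Proof.
move=> /Lfun2P[mf fi]; have mt := measurable_truncate N mf.
apply/Lfun2P; split=> //; apply: le_integrable fi => //.
  by apply/measurable_EFinP; exact: measurable_funX.
by move=> x _ /=; rewrite lee_fin !ger0_norm ?sqr_ge0 ?truncate_sqr_le.
Qed.

Lemma Lfun2_truncate_sub N f : f \in Lfun mu 2%:E ->
  (fun x => f x - truncate N f x) \in Lfun mu 2%:E.
Proof.
move=> /Lfun2P[mf fi]; have mt := measurable_truncate N mf.
have ms : measurable_fun setT (fun x => f x - truncate N f x).
  exact: measurable_funB.
apply/Lfun2P; split=> //; apply: le_integrable fi => //.
  by apply/measurable_EFinP; exact: measurable_funX.
by move=> x _ /=; rewrite lee_fin !ger0_norm ?sqr_ge0 ?truncate_sub_sqr_le.
Qed.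

(** At each x the truncation at level N is exact once N exceeds |x| and |f x|, and
    the squared error is dominated by f^2. *)
Lemma energy_truncate_sub_cvg0 f : f \in Lfun mu 2%:E ->
  energy (fun x => f x - truncate N%:R f x) @[N --> \oo] --> 0.
Proof.
move=> /[dup] f2 /Lfun2P[mf fi].
have ms N : measurable_fun setT
    (fun x => ((f x - truncate N%:R f x) ^+ 2)%:E).
  apply/measurable_EFinP; apply: measurable_funX; apply: measurable_funB => //.
  exact: measurable_truncate.
have [] := @dominated_convergence _ _ R mu _ measurableT
  (fun N x => ((f x - truncate N%:R f x) ^+ 2)%:E) (cst 0%E)
  (EFin \o (fun x => f x ^+ 2)) ms.
- exact: measurable_cst.
- apply/aeW => x _; apply/fine_cvgP; split; first exact: nearW.
  apply: cvg_near_cst.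
  near=> N; rewrite /= /truncate ifT ?subrr ?expr0n//.
  apply/andP; split; near: N; exact: nbhs_infty_ger.
- exact: fi.
- by apply/aeW => x N _; rewrite lee_fin ger0_norm ?sqr_ge0 ?truncate_sub_sqr_le.
move=> _ _; rewrite integral0 => /fine_cvgP[_].
by [].
Unshelve. all: by end_near. Qed.

End SquareIntegrable.

(** * Continuity of the cross-correlation *)

Section XcorrContinuity.
Context {R : realType}.
Local Notation mu := (@lebesgue_measure R).

(** The three-epsilon argument: a function that is arbitrarily close, near tau, to
    functions continuous at tau is continuous at tau. *)
Lemma cvg_locally_uniform_approx (gam : R -> R) (tau : R) :
  (forall eps : R, 0 < eps -> exists2 k : R -> R, k u @[u --> tau] --> k tau &
    \forall u \near tau, `|gam u - k u| <= eps) ->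
  gam u @[u --> tau] --> gam tau.
Proof.
move=> H; apply/cvgrPdist_le => eps e0.
have [k kc gk] := H (eps / 3) (divr_gt0 e0 (ltr0n _ 3)).
have gkt : `|gam tau - k tau| <= eps / 3 by exact: nbhs_singleton gk.
move/cvgrPdist_le : kc => /(_ (eps / 3) (divr_gt0 e0 (ltr0n _ 3))) kc.
near=> u.
have h1 : `|gam u - k u| <= eps / 3 by near: u.
have h2 : `|k tau - k u| <= eps / 3 by near: u.
have -> : gam tau - gam u =
  (gam tau - k tau) + ((k tau - k u) - (gam u - k u)) by ring.
apply: le_trans (ler_normD _ _) _.
have := ler_normB (k tau - k u) (gam u - k u); lra.
Unshelve. all: by end_near. Qed.

Lemma segment_bounded (q : R -> R) (B : R) : continuous q ->
  exists Q : R, forall x, `|x| <= B -> `|q x| <= Q.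
Proof.
move=> cq; have : compact (q @` `[- B, B]%classic).
  apply: continuous_compact; last exact: segment_compact.
  exact: continuous_subspaceT.
move=> /compact_bounded [Q [_ /(_ (Q + 1))]] Qb; exists (Q + 1) => x xB.
apply: Qb; first by rewrite ltrDl.
by exists x => //=; rewrite in_itv/= -ler_norml.
Qed.

Lemma xcorr_segment (f g : R -> R) (N u : R) :
  (forall x, N < `|x| -> f x = 0) ->
  xcorr f g u = \int[mu]_(x in `[- N, N]) (f x * g (x - u)).
Proof.
move=> f0; rewrite Rintegral_mkcond; apply: eq_Rintegral => x _.
rewrite patchE; case: ifPn => // /negP xN; rewrite f0 ?mul0r//.
rewrite ltNge; apply/negP => xN'; apply: xN.
by rewrite inE/= in_itv/= -ler_norml.
Qed.

(** The segment [- N, N] shifted by u stays inside [- B, B]. *)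
Lemma shift_integral_le (g : R -> R) (N B u : R) :
  measurable_fun setT g -> N + `|u| <= B ->
  (\int[mu]_(x in `[(- N)%R, N]) `|g (x - u)|%:E <=
   \int[mu]_(x in `[(- B)%R, B]) `|g x|%:E)%E.
Proof.
move=> mg NB; pose D := `[- N, N]%classic : set R.
pose E := `[- B, B]%classic : set R.
have mabs : measurable_fun setT (fun x => `|g x|%:E).
  by apply/measurable_EFinP; exact: measurableT_comp.
have mE : measurable_fun setT ((fun x => `|g x|%:E) \_ E).
  apply: (measurable_restrictT _ _).1; first exact: measurable_itv.
  exact: measurable_funTS.
have E0 x : (0 <= ((fun x => `|g x|%:E) \_ E) x)%E.
  by rewrite patchE; case: ifP.
rewrite [leRHS]integral_mkcond [leLHS]integral_mkcond.
rewrite (@ge0_integral_affine _ 1 (- u) _ (oner_neq0 R) mE E0) normr1 mul1e.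
apply: ge0_le_integral => //.
- by move=> x _; rewrite patchE; case: ifP.
- apply: (measurable_restrictT _ _).1; first exact: measurable_itv.
  apply: measurable_funTS; apply/measurable_EFinP; apply: measurableT_comp => //.
  by apply: measurableT_comp => //; exact: measurable_funB.
- apply: (measurableT_comp mE).
  by apply: measurable_affine.
(* Outside its set a restriction takes the default value of the type, here 0. *)
move=> x _; rewrite !mul1r !patchE -[point]/(0%E).
case: ifPn => [|_]; last by case: ifP.
rewrite inE /D /= in_itv/= -ler_norml => xN; rewrite ifT//.
rewrite inE /E /= in_itv/= -ler_norml; apply: le_trans NB.
by apply: le_trans (ler_normB _ _) _; rewrite lerD2r.
Qed.

(** Only the values of g on a segment [- B, B] matter for shifts u within distance
    1 of tau.  There g is L1-close to a continuous function q, and the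
    cross-correlation with q is continuous by dominated convergence; the error of
    replacing g by q is at most N times the L1 error on [- B, B], uniformly in u. *)
Lemma xcorr_continuous_bounded (f g : R -> R) (N : R) :
  measurable_fun setT f -> measurable_fun setT g ->
  0 <= N -> (forall x, `|f x| <= N) -> (forall x, N < `|x| -> f x = 0) ->
  (forall B, mu.-integrable `[- B, B]%classic (EFin \o g)) ->
  continuous (xcorr f g).
Proof.
move=> mf mg N0 fN f0 ig tau; apply: cvg_locally_uniform_approx => eps e0.
pose B := N + `|tau| + 1; pose D := `[- N, N]%classic : set R.
have mD : measurable D by exact: measurable_itv.
have finD : (mu D < +oo)%E.
  by rewrite lebesgue_measure_itv/=; case: ifP => _; rewrite ltry.
have finB : (mu `[(- B)%R, B]%classic < +oo)%E.
  by rewrite lebesgue_measure_itv/=; case: ifP => _; rewrite ltry.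
have [q_ [qc qi qg]] := approximation_continuous_integrable
  (measurable_itv `[- B, B]) finB (ig B).
(* N + 1 instead of N covers N = 0. *)
have e1 : 0 < eps / (N + 1) by rewrite divr_gt0// ltr_wpDl.
have [q [cq gqe]] : exists q : R -> R, continuous q /\
    (\int[mu]_(z in `[(- B)%R, B]) `|(g z - q z)%:E| <= (eps / (N + 1))%:E)%E.
  have /fine_cvgP[fin /cvgrPdist_le] := qg.
  move=> /(_ _ e1) close.
  near \oo => n.
  exists (q_ n); split=> //.
  have fn : (\int[mu]_(z in `[(- B)%R, B]) `|(g z - q_ n z)%:E|)%E \is a fin_num.
    by near: n.
  rewrite -(fineK fn) lee_fin.
  have : `|0 - fine (\int[mu]_(z in `[(- B)%R, B]) `|(g z - q_ n z)%:E|)%E|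
      <= eps / (N + 1) by near: n.
  by rewrite sub0r normrN; apply: le_trans; exact: ler_norm.
have mq : measurable_fun setT q by exact: continuous_measurable_fun.
have [Q qQ] := segment_bounded B cq.
have near_bound u x : tau - 1 < u < tau + 1 -> `|x| <= N -> `|x - u| <= B.
  move=> /andP[u1 u2] xN; apply: le_trans (ler_normB _ _) _; rewrite /B -addrA.
  apply: lerD => //.
  have -> : u = tau + (u - tau) by ring.
  apply: le_trans (ler_normD _ _) _; rewrite lerD2l ler_norml; lra.
have mfq u : measurable_fun D (fun x => f x * q (x - u)).
  apply: measurable_funTS; apply: measurable_funM => //.
  by apply: measurableT_comp => //; exact: measurable_funB.
have ifq u : tau - 1 < u < tau + 1 ->
    mu.-integrable D (EFin \o (fun x => f x * q (x - u))).
  move=> ut; apply: measurable_bounded_integrable;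
    [exact: measurable_itv|exact: finD|exact: mfq|].
  exists (N * Q); split; first exact: num_real.
  move=> M NM x; rewrite /D/= in_itv/= -ler_norml => xN.
  apply: le_trans (ltW NM); rewrite normrM ler_pM//.
  exact/qQ/near_bound.
(* On ]tau - 1, tau + 1[ the integrand is dominated by the constant N * Q. *)
exists (fun u => \int[mu]_(x in D) (f x * q (x - u))).
  apply: (@continuity_under_integral R _ _ mu (fun u x => f x * q (x - u)) D _
    (tau - 1) (tau + 1) _ _ (fun=> N * Q)).
  - exact: measurable_itv.
  - by move=> u /=; rewrite in_itv/= => /ifq.
  - apply/aeW => x _ u _; apply: cvgM; first exact: cvg_cst.
    apply: (@continuous_comp _ _ _ (fun u => x - u) q); last exact: cq.
    by apply: continuousB => //; exact: cvg_cst.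
  - apply: measurable_bounded_integrable; [exact: measurable_itv|exact: finD|by []|].
    exists (N * Q); split; first exact: num_real.
    move=> M NM x _ /=; apply: le_trans (ltW NM).
    by rewrite ger0_norm// mulr_ge0// (le_trans _ (qQ 0 _))// normr0 /B !addr_ge0.
  - move=> u /=; rewrite in_itv/= => ut; apply/aeW => x.
    rewrite /D/= in_itv/= -ler_norml => xN.
    by rewrite normrM ler_pM//; exact/qQ/near_bound.
  - by rewrite inE/= in_itv/=; apply/andP; split; lra.
have : \forall u \near tau, tau - 1 < u < tau + 1.
  have : tau \in `]tau - 1, tau + 1[ by rewrite in_itv/=; apply/andP; split; lra.
  by move=> /near_in_itvoo; apply: filterS => u; rewrite in_itv.
apply: filterS => u ut.
have ub : N + `|u| <= B.
  have -> : u = tau + (u - tau) by ring.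
  rewrite /B -addrA lerD2l; apply: le_trans (ler_normD _ _) _.
  rewrite lerD2l ler_norml; lra.
have gu : mu.-integrable D (EFin \o (fun x => g (x - u))).
  apply/integrableP; split.
    apply/measurable_EFinP/measurable_funTS; apply: measurableT_comp => //.
    exact: measurable_funB.
  apply: le_lt_trans (shift_integral_le mg ub) _.
  by case/integrableP : (ig B).
have mfg : measurable_fun setT (fun x => f x * g (x - u)).
  apply: measurable_funM => //; apply: measurableT_comp => //.
  exact: measurable_funB.
have ifg : mu.-integrable D (EFin \o (fun x => f x * g (x - u))).
  apply: (@le_integrable _ _ R mu D mD
     _ (EFin \o (fun x => N * g (x - u)))).
  - exact/measurable_EFinP/measurable_funTS.
  - move=> x _ /=; rewrite lee_fin !normrM ler_wpM2r//.
    by apply: le_trans (fN x) _; exact: ler_norm.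
  - exact: (@integrableZl _ _ R mu D mD N _ gu).
rewrite -[X in X - _]/(xcorr f g u) (xcorr_segment _ _ f0).
rewrite -RintegralB//; last exact: ifq.
have isub := @integrableB _ _ R mu D mD _ _ ifg (ifq u ut).
rewrite -lee_fin EFin_normr_Rintegral//.
apply: le_trans.
  by apply: le_abse_integral => //; case/integrableP : isub.
apply: (@le_trans _ _ (N%:E * \int[mu]_(x in D) `|g (x - u) - q (x - u)|%:E)%E).
  rewrite -ge0_integralZl//; first last.
  - apply/measurable_EFinP; apply: measurable_funTS; apply: measurableT_comp => //.
    apply: measurable_funB; apply: measurableT_comp => //; exact: measurable_funB.
  apply: ge0_le_integral => //.
  - by apply: measurableT_comp => //; case/integrableP : isub.
  - apply/measurable_EFinP; apply: measurable_funM => //.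
    apply: measurable_funTS; apply: measurableT_comp => //.
    apply: measurable_funB; apply: measurableT_comp => //; exact: measurable_funB.
  - move=> x _; rewrite lee_fin -mulrBr normrM.
    exact: ler_wpM2r.
apply: (@le_trans _ _ (N%:E * (eps / (N + 1))%:E)%E).
  rewrite lee_wpmul2l ?lee_fin//; apply: le_trans gqe.
  apply: (@shift_integral_le (fun x => g x - q x)) => //.
  exact: measurable_funB.
rewrite -EFinM lee_fin mulrCA ler_piMr ?(ltW e0)//.
by rewrite ler_pdivrMr ?mul1r ?lerDl// ltr_wpDl.
Unshelve. all: by end_near. Qed.

(** On a set of finite measure |g| <= 1 + g^2 is an integrable bound. *)
Lemma Lfun2_integrable_segment (g : R -> R) (B : R) :
  g \in Lfun mu 2%:E -> mu.-integrable `[- B, B]%classic (EFin \o g).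
Proof.
move=> /Lfun2P[mg gi]; pose D : set R := `[- B, B]%classic.
have mD : @measurable _ (measurableTypeR R) D by exact: measurable_itv.
have i1 : mu.-integrable D (EFin \o (fun=> 1)).
  apply: (measurable_bounded_integrable mD) => //=.
    by rewrite lebesgue_measure_itv/=; case: ifP => _; rewrite ltry.
  by exists 1; split=> // M M1 x _ /=; rewrite normr1 ltW.
have gD := integrableS measurableT mD (@subsetT _ _) gi.
apply: (le_integrable mD _ _ (integrableD mD i1 gD)).
  exact/measurable_EFinP/measurable_funTS.
move=> x _ /=; rewrite lee_fin; apply: le_trans (ler_norm _).
rewrite -(real_normK (num_real (g x))).
have := sqr_ge0 (`|g x| - 2^-1).
have -> : (`|g x| - 2^-1) ^+ 2 = `|g x| ^+ 2 - `|g x| + 4^-1 by field.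
lra.
Qed.

(** Truncating f reduces to [xcorr_continuous_bounded]: the truncation error has
    small energy, hence a small cross-correlation with every shift of g. *)
Lemma xcorr_continuous (f g : R -> R) :
  f \in Lfun mu 2%:E -> g \in Lfun mu 2%:E -> continuous (xcorr f g).
Proof.
move=> f2 g2 tau; apply: cvg_locally_uniform_approx => eps e0.
have Eg := energy_ge0 g; have E1 : 0 < energy g + 1 by rewrite ltr_wpDl.
(* With this weight the contribution energy g / c of g is at most eps; the level
   N is then chosen so that c times the truncation error is at most eps. *)
pose c := (energy g + 1) / eps.
have c0 : 0 < c by rewrite divr_gt0.
have ec0 : 0 < eps / c by rewrite divr_gt0.
have close : \forall N \near \oo,
    `|0 - energy (fun x => f x - truncate N%:R f x)| <= eps / c.
  by have /cvgrPdist_le := energy_truncate_sub_cvg0 f2; exact.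
have [N En] : exists N : nat,
    energy (fun x => f x - truncate N%:R f x) <= eps / c.
  near (\oo : set_system nat) => N; exists N.
  have : `|0 - energy (fun x => f x - truncate N%:R f x)| <= eps / c by near: N.
  by rewrite sub0r normrN; apply: le_trans; exact: ler_norm.
have t2 := Lfun2_truncate N%:R f2.
have [mf _] := (Lfun2P f).1 f2; have [mg _] := (Lfun2P g).1 g2.
exists (xcorr (truncate N%:R f) g).
  apply: (xcorr_continuous_bounded (N := N%:R)) => //.
  - exact: measurable_truncate.
  - by move=> x; rewrite /truncate; case: ifP => [/andP[]//|_]; rewrite normr0.
  - by move=> x Nx; rewrite /truncate leNgt Nx.
  - by move=> B; exact: Lfun2_integrable_segment.
near=> u.
have -> : xcorr f g u - xcorr (truncate N%:R f) g u =
    xcorr (fun x => f x - truncate N%:R f x) g u.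
  rewrite /xcorr -RintegralB//; try exact: xcorr_integrable.
  by apply: eq_Rintegral => x _; rewrite mulrBl.
apply: le_trans (abs_xcorr_le u c0 (Lfun2_truncate_sub _ f2) g2) _.
have h1 : c * energy (fun x => f x - truncate N%:R f x) <= eps.
  by rewrite mulrC -ler_pdivlMr.
have h2 : c^-1 * energy g <= eps.
  rewrite /c invf_div mulrAC ler_pdivrMr// ler_wpM2l// ?lerDl//.
  exact: ltW.
lra.
Unshelve. all: by end_near. Qed.

Lemma measurable_xcorr (f g : R -> R) :
  f \in Lfun mu 2%:E -> g \in Lfun mu 2%:E -> measurable_fun setT (xcorr f g).
Proof.
by move=> f2 g2; apply: continuous_measurable_fun; exact: xcorr_continuous.
Qed.

End XcorrContinuity.

(** * Covariances as integrals against a cross-correlation *)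

Section CovarianceLimit.
Context {R : realType}.
Local Notation mu := (@lebesgue_measure R).

(** Substitute y = x - u and integrate over x first.  Fubini's theorem applies
    because the absolute cross-correlation of a and b is bounded uniformly in u and
    Gamma is integrable. *)
Lemma covariance_xcorr (Gamma a b : R -> R) :
  Gamma \in Lfun mu 1%E -> a \in Lfun mu 2%:E -> b \in Lfun mu 2%:E ->
  \int[mu]_x \int[mu]_y (Gamma (x - y) * a x * b y) =
  \int[mu]_u (Gamma u * xcorr a b u).
Proof.
move=> /Lfun1_integrable Gi a2 b2.
have mG : measurable_fun setT Gamma by case/integrableP : Gi => /measurable_EFinP.
have [ma _] := (Lfun2P a).1 a2; have [mb _] := (Lfun2P b).1 b2.
pose F (z : R * R) := Gamma z.2 * (a z.1 * b (z.1 - z.2)).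
have mF : measurable_fun setT F.
  apply: measurable_funM; first exact: measurableT_comp.
  apply: measurable_funM; first exact: measurableT_comp.
  by apply: measurableT_comp => //; exact: measurable_funB.
transitivity (\int[mu]_x \int[mu]_u F (x, u)).
  apply: eq_Rintegral => x _.
  rewrite (@Rintegral_affine _ (-1) x) ?oppr_eq0 ?oner_neq0//; last first.
    apply: measurable_funM => //; apply: measurable_funM => //.
    by apply: measurableT_comp => //; exact: measurable_funB.
  rewrite normrN1 mul1r; apply: eq_Rintegral => u _.
  rewrite /F/= mulN1r opprD opprK addrCA subrr addr0 mulrA.
  by congr (_ * _ * b _); rewrite addrC.
rewrite Rintegral_fubini; last first.
  apply/integrable21ltyP; first exact/measurable_EFinP.
  have /integrableP[mGi Gfin] := Gi.
  apply: (@le_lt_trans _ _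
    (\int[mu]_u (((energy a + energy b) / 2)%:E * `|(EFin \o Gamma) u|))%E).
    apply: ge0_le_integral => //.
    - by move=> u _; exact: integral_ge0.
    - apply: (measurable_fun_fubini_tonelli_G (m1 := mu)
        (fun z => `|(EFin \o F) z|)%E) => //.
      by apply: measurableT_comp => //; exact/measurable_EFinP.
    - by apply: emeasurable_funM => //; exact: measurableT_comp.
    move=> u _ /=.
    have ixc := xcorr_integrable u a2 b2.
    under eq_integral do rewrite /F/= normrM EFinM.
    rewrite ge0_integralZl//; last first.
      by case/integrableP : (integrable_norm ixc).
    rewrite muleC lee_wpmul2r// -[leLHS]fineK; last first.
      by apply: integrable_fin_num => //; exact: integrable_norm.
    rewrite lee_fin; have := @xcorr_abs_le _ a b u 1 ltr01 a2 b2.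
    by rewrite invr1 !mul1r.
  rewrite ge0_integralZl//.
  - by rewrite lte_mul_pinfty// lee_fin divr_ge0// addr_ge0// energy_ge0.
  - exact: measurableT_comp.
  - by rewrite lee_fin divr_ge0// addr_ge0// energy_ge0.
apply: eq_Rintegral => u _; rewrite /F/= RintegralZl//.
exact: xcorr_integrable.
Qed.

(** Dominated convergence: the argument of the cross-correlation tends to - l for
    every u, and a constant multiple of |Gamma| dominates. *)
Lemma cvg_Rintegral_rescaled_xcorr (Gamma f g : R -> R) (M : nat) (l : R) :
  (2 <= M)%N -> Gamma \in Lfun mu 1%E ->
  f \in Lfun mu 2%:E -> g \in Lfun mu 2%:E ->
  \int[mu]_u (Gamma u * xcorr f g (M%:R ^ (- j%:Z) * u - l)) @[j --> \oo] -->
  (\int[mu]_u Gamma u) * xcorr f g (- l).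
Proof.
move=> hM /Lfun1_integrable Gi f2 g2.
have mG : measurable_fun setT Gamma by case/integrableP : Gi => /measurable_EFinP.
have cx := xcorr_continuous f2 g2; have mx := measurable_xcorr f2 g2.
rewrite -RintegralZr//.
set C := (energy f + energy g) / 2.
have xC u : `|xcorr f g u| <= C.
  by have := abs_xcorr_le u ltr01 f2 g2; rewrite invr1 !mul1r.
have mj j : measurable_fun setT
    (fun u => (Gamma u * xcorr f g (M%:R ^ (- j%:Z) * u - l))%:E).
  apply/measurable_EFinP; apply: measurable_funM => //.
  exact: (measurableT_comp mx (measurable_affine _ _)).
have scales u : (M%:R ^ (- j%:Z) * u - l : R) @[j --> \oo] --> - l.
  rewrite -[X in _ --> X]add0r; apply: cvgB; last exact: cvg_cst.
  rewrite -(mul0r u); apply: cvgMl.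
  under eq_fun do rewrite -exprnN -exprVn.
  apply: cvg_expr; rewrite ger0_norm ?invr_ge0// invf_lt1 ?ltr1n//.
  by rewrite ltr0n (leq_trans _ hM).
have [] := @dominated_convergence _ _ R mu _ measurableT
  (fun (j : nat) u => (Gamma u * xcorr f g (M%:R ^ (- j%:Z) * u - l))%:E)
  (fun u => (Gamma u * xcorr f g (- l))%:E)
  (fun u => (C%:E * `|(EFin \o Gamma) u|)%E) mj.
- by apply/measurable_EFinP; exact: measurable_funM.
- apply/aeW => u _; apply/fine_cvgP; split; first exact: nearW.
  apply: cvgM; first exact: cvg_cst.
  exact: (cvg_comp _ _ (scales u) (cx _)).
- by apply: integrableZl => //; exact: integrable_abse.
- apply/aeW => u j _; rewrite /= -EFinM lee_fin normrM mulrC.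
  exact: ler_wpM2r.
move=> ilim _; rewrite -[X in _ --> X -> _]fineK.
  by move=> /fine_cvgP[_].
exact: integrable_fin_num.
Qed.

End CovarianceLimit.

(** * Dilated atoms *)

Section Atoms.
Context {R : realType}.
Local Notation mu := (@lebesgue_measure R).

Lemma atom_prefactor_sqr (M : nat) (j : int) : (0 < M)%N ->
  (M%:R : R) `^ (- (j%:~R / 2)) * M%:R `^ (- (j%:~R / 2)) = M%:R ^ (- j).
Proof.
move=> M0; rewrite -powRD; last by rewrite pnatr_eq0 -lt0n M0 implybT.
rewrite -opprD -splitr -powR_intmul ?ler0n//.
by rewrite mulrNz.
Qed.

Lemma Lfun2_atom (M : nat) (f : R -> R) (j k : int) : (0 < M)%N ->
  f \in Lfun mu 2%:E -> atom M f j k \in Lfun mu 2%:E.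
Proof.
move=> M0 f2; have s0 : (M%:R : R) ^ (- j) != 0.
  by rewrite expfz_neq0// pnatr_eq0 -lt0n.
have le12 : (1 : R) <= 2 by rewrite ler1n.
have := Lfun_scale (M%:R `^ (- (j%:~R / 2)) : R) le12 (Lfun2_affine (- k%:~R) s0 f2).
rewrite (_ : _ \o* _ = atom M f j k)//.
by apply/funext => x; rewrite /atom /= mulrC.
Qed.

(** The substitution y = M^(-j) x - (k + l); its Jacobian M^j cancels the square of
    the normalisation M^(-j/2), and the position k disappears. *)
Lemma xcorr_atom (M : nat) (f g : R -> R) (j k l : int) (u : R) : (0 < M)%N ->
  f \in Lfun mu 2%:E -> g \in Lfun mu 2%:E ->
  xcorr (atom M f j (k + l)) (atom M g j k) u =
  xcorr f g (M%:R ^ (- j) * u - l%:~R).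
Proof.
move=> M0 f2 g2; set s : R := M%:R ^ (- j).
have s0 : 0 < s by rewrite exprz_gt0// ltr0n.
have ifg := xcorr_integrable (s * u - l%:~R) f2 g2.
have iafg := integrable_affine (- (k + l)%:~R) (lt0r_neq0 s0) ifg.
have mfg : measurable_fun setT (fun x => f x * g (x - (s * u - l%:~R))).
  by case/integrableP : ifg => /measurable_EFinP.
rewrite /xcorr (Rintegral_affine (- (k + l)%:~R) (lt0r_neq0 s0) mfg).
rewrite gtr0_norm// -RintegralZl//.
apply: eq_Rintegral => x _; rewrite /atom -/s mulrACA atom_prefactor_sqr//.
congr (_ * (_ * g _)); rewrite intrD; ring.
Qed.

End Atoms.

(** * The limit of the coefficient covariances *)

Section CoefficientCovariance.
Context {d : measure_display} {T : measurableType d} {R : realType}.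
Context (P : probability T R) (n : R -> {RV P >-> R}).
Local Notation mu := (@lebesgue_measure R).

(** Stationarity turns the kernel of the exchanged double integral into Gamma(x - y),
    to which [covariance_xcorr] and then [xcorr_atom] apply. *)
Lemma crosscov_coef (Gamma f g : R -> R) (M : nat) (j k l : int) :
  (0 < M)%N -> wide_sense_stationary n Gamma -> Gamma \in Lfun mu 1%E ->
  f \in Lfun mu 2%:E -> g \in Lfun mu 2%:E ->
  exchangeable_with n (atom M f j (k + l)) (atom M g j k) ->
  crosscov P (coef n M f j) (coef n M g j) k l =
  \int[mu]_u (Gamma u * xcorr f g (M%:R ^ (- j) * u - l%:~R)).
Proof.
move=> M0 hn G1 f2 g2 hex; rewrite /crosscov /coef hex /=.
transitivity (\int[mu]_x \int[mu]_y
    (Gamma (x - y) * atom M f j (k + l) x * atom M g j k y)).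
  apply: eq_Rintegral => x _; apply: eq_Rintegral => y _.
  by have := wss_autocovariance hn (x - y) y; rewrite addrC subrK => ->.
rewrite covariance_xcorr//; try exact: Lfun2_atom.
by apply: eq_Rintegral => u _; rewrite xcorr_atom.
Qed.

End CoefficientCovariance.

Lemma fourier0 (R : realType) (f : R -> R) :
  fourier f 0 = (\int[lebesgue_measure]_t f t)%:C.
Proof.
rewrite /fourier /fourier_on /cintegral; congr (_ +i* _).
  apply: eq_Rintegral => t _.
  by rewrite /expi mul0r oppr0 cos0 sin0 /= mulr1 mul0r subr0.
transitivity (\int[lebesgue_measure]_(t in setT : set R) (0 : R)).
  apply: eq_Rintegral => t _.
  by rewrite /expi mul0r oppr0 cos0 sin0 /= mulr0 mul0r addr0.
by rewrite Rintegral_cst// mul0r.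
Qed.

Lemma cvg_real_complex (R : realType) (u : nat -> R) (a : R) :
  u j @[j --> \oo] --> a ->
  ((u j)%:C : complex_numField R) @[j --> \oo] --> (a%:C : complex_numField R).
Proof.
move=> /cvgrPdist_lt ua; apply/cvgrPdist_lt => eps e0.
have [e e0' epsE] : exists2 e : R, 0 < e & eps = e%:C.
  case: eps e0 => x y; rewrite ltcE /= => /andP[/eqP -> x0].
  by exists x.
have := ua e e0'; apply: filterS => j.
rewrite -rmorphB normc_def /= expr0n addr0 sqrtr_sqr epsE.
by rewrite ltcR.
Qed.

(** xcorr (psi m) (psi m') (- l) is the inner product of psi m with the translate
    psi m' (x + l), two members of the orthonormal family. *)
Lemma xcorr_mband (R : realType) (M : nat) (psi : nat -> R -> R)
    (m m' : nat) (l : int) (hm : (m < M)%N) (hm' : (m' < M)%N) :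
  Defs.orthonormal (fun mk : 'I_M * int => atom M (psi mk.1) 0 mk.2) ->
  xcorr (psi m) (psi m') (- l%:~R) = ((m == m') && (l == 0))%:R.
Proof.
move=> [_ /(_ (Ordinal hm, 0) (Ordinal hm', - l))] /=.
have -> : ((Ordinal hm, 0) == (Ordinal hm', - l)) = (m == m') && (l == 0).
  by rewrite xpair_eqE -val_eqE /= [0 == _]eq_sym oppr_eq0.
move=> <-; apply: eq_Rintegral => x _; rewrite /atom.
by rewrite oppr0 expr0z !mul0r !oppr0 !powRr0 !mul1r mulrNz addr0.
Qed.

Theorem proposition7 (R : realType) (disp : measure_display)
    (T : measurableType disp) (P : probability T R)
    (M : nat) (hM : (2 <= M)%N)
    (psi : nat -> R -> R) (hpsi : nat -> R -> R[i]) (H : nat -> R -> R[i])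
    (hwav : mband_wavelets M psi hpsi H)
    (d : int) (psiH : nat -> R -> R) (hpsiH : nat -> R -> R[i])
    (hdual : dual_wavelets M d hpsi psiH hpsiH)
    (n : R -> {RV P >-> R}) (Gamma : R -> R)
    (hn : wide_sense_stationary n Gamma)
    (hGamma1 : Gamma \in Lfun (@lebesgue_measure R) 1%E)
    (hGamma2 : Gamma \in Lfun (@lebesgue_measure R) 2%:E)
    (hexch : legitimate_exchange n M psi psiH)
    (m m' : nat) (hm : (m < M)%N) (hm' : (m' < M)%N) (l k : int) :
  (((crosscov P (coef n M (psi m) j%:Z) (coef n M (psi m') j%:Z) k l)%:C
      : complex_numField R) @[j --> \oo] -->
    (fourier Gamma 0 * (m == m')%:R * (l == 0)%:R : complex_numField R)) /\
  (((crosscov P (coef n M (psi m) j%:Z) (coef n M (psiH m') j%:Z) k l)%:C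
      : complex_numField R) @[j --> \oo] -->
    (fourier Gamma 0 * (xcorr (psi m) (psiH m') (- l%:~R))%:C
      : complex_numField R)).
Proof.
have M0 : (0 < M)%N by exact: leq_trans hM.
have psi2 i : (i < M)%N -> psi i \in Lfun (@lebesgue_measure R) 2%:E.
  by move=> /(mbw_fourier hwav)[].
have psiH2 i : (i < M)%N -> psiH i \in Lfun (@lebesgue_measure R) 2%:E.
  by move=> /(dual_fourier hdual)[].
have limit g : g \in Lfun (@lebesgue_measure R) 2%:E ->
    (forall j : int,
      exchangeable_with n (atom M (psi m) j (k + l)) (atom M g j k)) ->
    ((crosscov P (coef n M (psi m) j%:Z) (coef n M g j%:Z) k l)%:C
      : complex_numField R) @[j --> \oo] -->
    (fourier Gamma 0 * (xcorr (psi m) g (- l%:~R))%:C : complex_numField R).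
  move=> g2 hex; rewrite fourier0 -rmorphM; apply: cvg_real_complex.
  under eq_fun do rewrite (crosscov_coef M0 hn hGamma1 (psi2 _ hm) g2 (hex _)).
  exact: cvg_Rintegral_rescaled_xcorr hM hGamma1 (psi2 _ hm) g2.
split; last first.
  by apply: limit => [|j]; [exact: psiH2|have [] := hexch _ _ hm hm' j (k + l) k].
have -> : fourier Gamma 0 * (m == m')%:R * (l == 0)%:R =
    fourier Gamma 0 * (xcorr (psi m) (psi m') (- l%:~R))%:C.
  rewrite (xcorr_mband _ hm hm' (mbw_step hwav).1) -mulrA; congr (_ * _).
  by rewrite -natrM mulnb rmorph_nat.
by apply: limit => [|j]; [exact: psi2|have [] := hexch _ _ hm hm' j (k + l) k].
Qed.
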